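(* Let $K\subseteq\mathbf{R}^n$ be a nonempty unbounded closed set and let $f=(f_1,\dots,f_q):\mathbf{R}^n\to\mathbf{R}^q$ be a vector polynomial with $\deg f_i=d_i\ge1$, $\mathbf d=(d_1,\dots,d_q)$. Then: (i) Assume there exist $\bar x\in K$ and a nonempty index set $I\subseteq\{1,\dots,q\}$ such that $f$ is relatively $I$-$\mathbf{R}^q_+$-zero-regular with $K_{\bar x}$ on $K$. If $f$ is $I$-section-bounded from below at $\bar x$, then $SOL^{s}(K,f)$ is nonempty. (ii) Assume there exists $\bar x\in K$ such that $f$ is relatively $\mathbf{R}^q_+$-zero-regular with $K_{\bar x}$ on $K$. If $f$ is section-bounded from below at $\bar x$, then $SOL^{s}(K,f)$ is nonempty. (iii) Assume there exists $\bar x\in K$ such that $f$ is relatively strongly regular with $K_{\bar x}$ on $K$. If $f$ is $I$-section-bounded from below at $\bar x$ for some nonempty index set $I\subseteq\{1,\dots,q\}$, then $SOL^{s}(K,f)$ is nonempty. (iv) Assume there exists $\bar x\in K$ such that $f$ is relatively weakly regular with $K_{\bar x}$ on $K$. If $f$ is section-bounded from below at $\bar x$, then $SOL^{s}(K,f)$ is nonempty.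
   Context: $\mathbf{R}^q_+$ is the nonnegative orthant; $y\le z$ in $\mathbf{R}^q$ means $z-y\in\mathbf{R}^q_+$. $K_{\bar x}=\{x\in K: f(x)\le f(\bar x)\}$. The asymptotic cone of a nonempty set $S$ is $S_\infty=\{v:\exists\, t_k\to+\infty,\ x_k\in S \text{ with } x_k/t_k\to v\}$. For a polynomial $p$ of degree $d$, $p^\infty_d(x)=\lim_{t\to+\infty}p(tx)/t^d$, and $f^\infty_{\mathbf d}=((f_1)^\infty_{d_1},\dots,(f_q)^\infty_{d_q})$. $SOL(A,p)$ is the set of global minimizers of the scalar function $p$ over $A$. $SOL^{s}(A,g)=\{x^*\in A: g(x)-g(x^* )\notin-\mathbf{R}^q_+\setminus\{0\}\ \forall x\in A\}$, $SOL^{w}(A,g)=\{x^*\in A: g(x)-g(x^* )\notin-\operatorname{int}\mathbf{R}^q_+\ \forall x\in A\}$. $f$ is $I$-section-bounded from below at $\bar x$ if $f_i$ is bounded from below on $K_{\bar x}$ for every $i\in I$; it is section-bounded from below at $\bar x$ if this holds with $I=\{1,\dots,q\}$. Let $S$ be a nonempty closed set such that $(K_{\bar x})_\infty\subseteq S_\infty\subseteq K_\infty$ for some $\bar x\in K$. With $S$ on $K$, $f$ is: relatively $I$-$\mathbf{R}^q_+$-zero-regular if there is $\lambda\in\mathbf{R}^q_+\setminus\{0\}$ with $\{i:\lambda_i\ne0\}=I$ such that $SOL(S_\infty,\{\sum_i\lambda_i f_i\}^\infty_d)$, $d=\deg\sum_i\lambda_i f_i$, is bounded; relatively $\mathbf{R}^q_+$-zero-regular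 if this holds with $I=\{1,\dots,q\}$; relatively weakly regular if $SOL^{s}(S_\infty,f^\infty_{\mathbf d})$ is bounded; relatively strongly regular if $SOL^{w}(S_\infty,f^\infty_{\mathbf d})$ is bounded. (The empty set is bounded.) *)

(* Defs.v *)
From HB Require Import structures.
From mathcomp Require Import all_boot all_order all_algebra.
From mathcomp Require Import all_classical all_reals all_analysis.
(* The notations of mpoly clash with those of mathcomp-analysis. *)
From mathcomp Require Import -(notations) mpoly.

Set Implicit Arguments.
Unset Strict Implicit.
Unset Printing Implicit Defensive.

Import Order.TTheory GRing.Theory Num.Theory.
Import numFieldNormedType.Exports.

Local Open Scope classical_set_scope.
Local Open Scope ring_scope.

Notation mpolynomial R n := (mpoly n R).

Section Sets.
Context {R : realType}.

Definition orthant (q : nat) : set 'rV[R]_q := [set y | forall i, 0 <= y 0 i].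

Definition vle (q : nat) (y z : 'rV[R]_q) : Prop := orthant (z - y).

(* Some [t k] may vanish, but only for finitely many [k]. *)
Definition asymptotic_cone (n : nat) (S : set 'rV[R]_n) : set 'rV[R]_n :=
  [set v | exists (t : R^nat) (x : nat -> 'rV[R]_n),
     [/\ t @ \oo --> +oo, (forall k, S (x k)) &
         (fun k => (t k)^-1 *: x k) @ \oo --> v]].

Definition SOL (n : nat) (A : set 'rV[R]_n) (p : 'rV[R]_n -> R) :
    set 'rV[R]_n :=
  [set xs | A xs /\ forall x, A x -> p xs <= p x].

Definition SOLs (n q : nat) (A : set 'rV[R]_n) (g : 'rV[R]_n -> 'rV[R]_q) :
    set 'rV[R]_n :=
  [set xs | A xs /\ forall x, A x ->
     ~ ([set - y | y in @orthant q] `\ 0) (g x - g xs)].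

Definition SOLw (n q : nat) (A : set 'rV[R]_n) (g : 'rV[R]_n -> 'rV[R]_q) :
    set 'rV[R]_n :=
  [set xs | A xs /\ forall x, A x ->
     ~ [set - y | y in (@orthant q)°] (g x - g xs)].

End Sets.

Section Polynomials.
Context {R : realType} {n : nat}.

(* [deg] is the total degree; the zero polynomial gets degree 0, so that its
   recession polynomial is 0. *)
Definition deg (p : mpolynomial R n) : nat := (msize p).-1.

Definition peval (p : mpolynomial R n) (x : 'rV[R]_n) : R :=
  meval (x 0) p.

(* [lim] is a total operator; the limit exists whenever [deg p <= d]. *)
Definition recession (d : nat) (p : mpolynomial R n) (x : 'rV[R]_n) : R :=
  lim ((fun t : R => peval p (t *: x) / t ^+ d) @ +oo).

Context {q : nat}.

Definition veval (f : 'I_q -> mpolynomial R n) (x : 'rV[R]_n) : 'rV[R]_q :=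
  \row_i peval (f i) x.

Definition vrecession (d : 'I_q -> nat) (f : 'I_q -> mpolynomial R n)
    (x : 'rV[R]_n) : 'rV[R]_q :=
  \row_i recession (d i) (f i) x.

Definition weighted_sum (l : 'rV[R]_q) (f : 'I_q -> mpolynomial R n) :
    mpolynomial R n :=
  \sum_i l 0 i *: f i.

Definition section_at (K : set 'rV[R]_n) (f : 'I_q -> mpolynomial R n)
    (xb : 'rV[R]_n) : set 'rV[R]_n :=
  [set x | K x /\ vle (veval f x) (veval f xb)].

Definition I_section_bounded_below (I : set 'I_q) (K : set 'rV[R]_n)
    (f : 'I_q -> mpolynomial R n) (xb : 'rV[R]_n) : Prop :=
  forall i, I i -> has_lbound (peval (f i) @` section_at K f xb).

Definition section_bounded_below (K : set 'rV[R]_n)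
    (f : 'I_q -> mpolynomial R n) (xb : 'rV[R]_n) : Prop :=
  I_section_bounded_below setT K f xb.

(* The standing requirement on [S] in the three regularity notions. *)
Definition regularity_set (S K : set 'rV[R]_n)
    (f : 'I_q -> mpolynomial R n) : Prop :=
  [/\ S !=set0, closed S & exists xb, [/\ K xb,
      asymptotic_cone (section_at K f xb) `<=` asymptotic_cone S &
      asymptotic_cone S `<=` asymptotic_cone K]].

Definition rel_I_zero_regular (I : set 'I_q) (S K : set 'rV[R]_n)
    (f : 'I_q -> mpolynomial R n) : Prop :=
  regularity_set S K f /\
  exists l : 'rV[R]_q, [/\ (@orthant R q `\ 0) l, [set i | l 0 i != 0] = I &
    let p := weighted_sum l f in
    bounded_set (SOL (asymptotic_cone S) (recession (deg p) p))].

Definition rel_zero_regular (S K : set 'rV[R]_n)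
    (f : 'I_q -> mpolynomial R n) : Prop :=
  rel_I_zero_regular setT S K f.

Definition rel_weakly_regular (d : 'I_q -> nat) (S K : set 'rV[R]_n)
    (f : 'I_q -> mpolynomial R n) : Prop :=
  regularity_set S K f /\
  bounded_set (SOLs (asymptotic_cone S) (vrecession d f)).

Definition rel_strongly_regular (d : 'I_q -> nat) (S K : set 'rV[R]_n)
    (f : 'I_q -> mpolynomial R n) : Prop :=
  regularity_set S K f /\
  bounded_set (SOLw (asymptotic_cone S) (vrecession d f)).

End Polynomials.

(* Main.v *)
Require Import Defs.
From mathcomp Require Import all_boot all_order all_algebra.
From mathcomp Require Import all_classical all_reals all_analysis.
From mathcomp Require Import -(notations) mpoly.

Set Implicit Arguments.
Unset Strict Implicit.
Unset Printing Implicit Defensive.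

Import Order.TTheory GRing.Theory Num.Theory.
Import numFieldNormedType.Exports.
Local Open Scope classical_set_scope.
Local Open Scope ring_scope.

(** Write A for the section at xb: the points x of K with f x <= f xb. The key
    point is that each regularity hypothesis forces A to be bounded, hence
    compact.

    Every f i is bounded above on A, by its value at xb. If some polynomial p of
    degree at most d, with d > 0, is bounded on A from both sides, then its
    recession polynomial of degree d vanishes on the whole asymptotic cone of A:
    along x_k / t_k --> v with x_k in A, the quotients p(x_k) / t_k^d tend both
    to 0 and to the value of the recession polynomial at v
    ([recession_cvg], [recession_eq0]). So, under the boundedness assumptions,
    the recession problem degenerates and all of the asymptotic cone solves it:
    - for the weighted sum, the recession polynomial is 0 on the cone, or it is
      constant when the sum has degree 0;
    - in the strong case one component of the recession map vanishes on the
      cone, so that no point of it is strictly better than another in every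
      component;
    - in the weak case all components vanish.
    Regularity says that this solution set is bounded, so the asymptotic cone
    of A is bounded; being stable under positive scaling it has no nonzero
    point, and a set without nonzero asymptotic direction is bounded
    ([bounded_of_asymptotic_cone]).

    Finally, a minimiser of the sum of the f i over the compact set A is
    efficient on K, since a point of K that dominates it lies in A as well
    ([SOLs_neq0_of_bounded_section]). *)

(** * Asymptotic cones and boundedness *)

Lemma bounded_subset (R : realType) (n : nat) (A B : set 'rV[R]_n) :
  A `<=` B -> bounded_set B -> bounded_set A.
Proof.
move=> AB [M [Mreal BM]]; exists M; split=> // x Mx y /AB; exact: BM.
Qed.

Lemma closed_sublevel (R : realType) (T : topologicalType) (g : T -> R)
    (c : R) :
  continuous g -> closed [set x | g x <= c].
Proof.
by move=> /continuous_closedP/(_ [set r | r <= c]); apply; exact: closed_le.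
Qed.

Lemma asymptotic_cone_scale (R : realType) (n : nat) (A : set 'rV[R]_n)
    (s : R) (v : 'rV[R]_n) :
  0 < s -> asymptotic_cone A v -> asymptotic_cone A (s *: v).
Proof.
move=> s0 [t [x [toy Ax xv]]]; exists (fun k => s^-1 * t k), x; split => //.
  apply/cvgryPge => M; have /cvgryPge/(_ (s * M)) := toy.
  by apply: filterS => k; rewrite ler_pdivlMl.
under eq_fun do rewrite invfM invrK -scalerA.
exact: cvgZl_tmp.
Qed.

(** Points of A of arbitrarily large norm, once normalised, accumulate on the
    unit sphere by compactness; an accumulation point is the direction. *)
Lemma unbounded_asymptotic_direction (R : realType) (n : nat)
    (A : set 'rV[R]_n) :
  ~ bounded_set A -> exists2 v, asymptotic_cone A v & v != 0.
Proof.
move=> nbA.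
have farA (k : nat) : exists x, A x /\ k.+1%:R <= `|x|.
  apply: contrapT => /forallNP Ak; apply: nbA.
  exists k.+1%:R; split => // M kM x Ax; apply: ltW; apply: le_lt_trans kM.
  by rewrite leNgt; apply/negP => /ltW ?; apply: (Ak x).
have /choice[x xP] := farA.
pose y k := `|x k|^-1 *: x k.
have x_gt0 k : 0 < `|x k| by apply: lt_le_trans (xP k).2; rewrite ltr0n.
have ny k : `|y k| = 1.
  by rewrite normrZ gtr0_norm ?invr_gt0// mulVf// gt_eqF.
have compB : compact [set z : 'rV[R]_n | `|z| <= 1].
  apply: bounded_closed_compact.
    by exists 1; split=> // M M1 z /= /le_trans; apply; exact: ltW.
  by apply: closed_sublevel; exact: norm_continuous.
have [v [_ vy]] : [set z : 'rV[R]_n | `|z| <= 1] `&` cluster (y @ \oo) !=set0.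
  by apply: compB; exists 0%N => // k _ /=; rewrite ny.
have sub (k : nat) : exists m, (k <= m)%N /\ `|v - y m| < k.+1%:R^-1.
  have k0 : 0 < k.+1%:R^-1 :> R by rewrite invr_gt0 ltr0n.
  have ytail : (y @ \oo) (y @` [set m | (k <= m)%N]).
    by exists k => // m /= km; exists m.
  have [_ [[m /= km <-] vm]] := vy _ _ ytail (nbhsx_ballx v _ k0).
  by exists m; split=> //; rewrite -ball_normE in vm.
have /choice[m mP] := sub.
exists v; last first.
  apply/eqP => v0; have [m0 [_]] := sub 0%N.
  by rewrite v0 sub0r normrN ny invr1 ltxx.
exists (fun k => `|x (m k)|), (x \o m); split => [|k|] /=.
- apply/cvgryPge => M; have /cvgryPge/(_ M) := @cvgr_idn R.
  apply: filterS => k /le_trans; apply.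
  apply: le_trans (xP (m k)).2; rewrite ler_nat.
  exact: leq_trans (mP k).1 _.
- exact: (xP _).1.
- apply/cvgrPdist_lt => e e0; near=> k; apply: lt_trans (mP k).2 _.
  near: k; exact: near_infty_natSinv_lt (PosNum e0).
Unshelve. all: by end_near. Qed.

Lemma bounded_of_asymptotic_cone (R : realType) (n : nat) (A : set 'rV[R]_n) :
  bounded_set (asymptotic_cone A) -> bounded_set A.
Proof.
move=> bC; apply: contrapT => /unbounded_asymptotic_direction[v vC].
rewrite -normr_gt0 => v_gt0; have [M [_ CM]] := bC.
(* The multiple of v with norm |M| + 2 breaks the bound |M| + 1 > M. *)
pose s := (`|M| + 2) / `|v|.
have s0 : 0 < s by rewrite divr_gt0// ltr_wpDl.
have M1 : M < `|M| + 1 by rewrite ltr_pwDr// ler_norm.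
have /= := CM _ M1 _ (asymptotic_cone_scale s0 vC).
by rewrite normrZ gtr0_norm// divfK ?gt_eqF// lerD2l leNgt ltr1n.
Qed.

(** * Recession polynomials along sequences *)

Lemma peval_continuous (R : realType) (n : nat) (p : mpolynomial R n) :
  continuous (peval p).
Proof.
have -> : peval p = fun x : 'rV[R]_n =>
    \sum_(m <- msupp p) mcoeff m p * \prod_i x 0 i ^+ m i.
  by apply/funext => x; rewrite /peval mevalE.
move=> x; apply: (@cvg_big _ _ _ _ _ _ _ (nbhs x)) => [|m _].
  exact: add_continuous.
apply: cvgMl_tmp; apply: (@cvg_big _ _ _ _ _ _ _ (nbhs x)) => [|i _].
  exact: mul_continuous.
by apply: (continuous_comp (g := fun z : R => z ^+ m i));
  [exact: coord_continuous | exact: exprn_continuous].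
Qed.

(** A closed form of the recession polynomial, valid when the degree of p is at
    most d. *)
Definition leading_form (R : realType) (n d : nat) (p : mpolynomial R n)
    (v : 'rV[R]_n) : R :=
  \sum_(m <- msupp p) (mdeg m == d)%:R * (mcoeff m p * \prod_i v 0 i ^+ m i).

(** This is where the monomials of degree below d disappear in the limit. *)
Lemma cvg_expr_ratio (R : realType) (T : Type) (F : set_system T) (t : T -> R)
    (e d : nat) : Filter F -> t x @[x --> F] --> +oo -> (e <= d)%N ->
  t x ^+ e / t x ^+ d @[x --> F] --> ((e == d)%:R : R).
Proof.
move=> FF toy ed.
have t0 : \forall x \near F, 0 < t x by move/cvgryPgt/(_ 0): toy.
have : (t x)^-1 ^+ (d - e) @[x --> F] --> ((e == d)%:R : R).
  have -> : (e == d)%:R = 0 ^+ (d - e) :> R.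
    by rewrite expr0n subn_eq0 eqn_leq ed.
  have tV : (fun x => (t x)^-1) @ F --> (0 : R).
    by apply/gtr0_cvgV0.
  exact: (continuous_cvg FF (@exprn_continuous R (d - e) 0) tV).
apply: cvg_trans; apply: near_eq_cvg.
apply: filterS t0 => x x0.
rewrite -{2}(subnKC ed) exprD invfM mulrA divff ?mul1r ?exprVn//.
by rewrite expf_neq0// gt_eqF.
Qed.

(** The limit is taken with a moving direction y and along any filter: the ray
    t *: v gives the recession polynomial, and a sequence that defines an
    asymptotic direction gives [recession_cvg]. *)
Lemma peval_scale_cvg (R : realType) (n d : nat) (p : mpolynomial R n)
    (T : Type) (F : set_system T) (t : T -> R) (y : T -> 'rV[R]_n)
    (v : 'rV[R]_n) : Filter F -> (deg p <= d)%N ->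
  t x @[x --> F] --> +oo -> y x @[x --> F] --> v ->
  peval p (t x *: y x) / t x ^+ d @[x --> F] --> leading_form d p v.
Proof.
move=> FF pd toy yv.
have -> : (fun x => peval p (t x *: y x) / t x ^+ d) = fun x =>
    \sum_(m <- msupp p | m \in msupp p)
      (t x ^+ mdeg m / t x ^+ d) * (mcoeff m p * \prod_i y x 0 i ^+ m i).
  apply/funext => x; rewrite /peval mevalE mulr_suml big_seq.
  apply: eq_bigr => m _.
  have -> : \prod_i (t x *: y x) 0 i ^+ m i =
      t x ^+ mdeg m * \prod_i y x 0 i ^+ m i.
    rewrite mdegE -prodrXr -big_split; apply: eq_bigr => i _.
    by rewrite mxE exprMn.
  by rewrite mulrCA mulrAC.
rewrite /leading_form big_seq.
apply: cvg_big => [|m mp]; first exact: add_continuous.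
apply: cvgM.
  apply: cvg_expr_ratio => //; apply: leq_trans pd.
  by rewrite /deg -ltnS (ltn_predK (msize_mdeg_lt mp)) msize_mdeg_lt.
apply: cvgMl_tmp.
apply: cvg_big => [|i _]; first exact: mul_continuous.
apply: (continuous_cvg FF (@exprn_continuous R (m i) (v 0 i))).
exact: (continuous_cvg FF (@coord_continuous R 1 n 0 i v) yv).
Qed.

Lemma recessionE (R : realType) (n d : nat) (p : mpolynomial R n)
    (v : 'rV[R]_n) : (deg p <= d)%N -> recession d p v = leading_form d p v.
Proof.
move=> pd; apply: cvg_lim => //.
by apply: peval_scale_cvg => //; exact: cvg_cst.
Qed.

Lemma recession_cvg (R : realType) (n d : nat) (p : mpolynomial R n)
    (t : R^nat) (x : nat -> 'rV[R]_n) (v : 'rV[R]_n) : (deg p <= d)%N ->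
  t @ \oo --> +oo -> (fun k => (t k)^-1 *: x k) @ \oo --> v ->
  peval p (x k) / t k ^+ d @[k --> \oo] --> recession d p v.
Proof.
move=> pd toy xv; rewrite recessionE//.
apply: cvg_trans (peval_scale_cvg _ pd toy xv); apply: near_eq_cvg.
have := toy; move/cvgryPgt/(_ 0); apply: filterS => k k0.
by rewrite scalerA divff ?scale1r// gt_eqF.
Qed.

Lemma recession_le0 (R : realType) (n d : nat) (p : mpolynomial R n)
    (A : set 'rV[R]_n) (M : R) (v : 'rV[R]_n) :
  (deg p <= d)%N -> (0 < d)%N -> (forall x, A x -> peval p x <= M) ->
  asymptotic_cone A v -> recession d p v <= 0.
Proof.
move=> pd d0 pM [t [x [toy Ax xv]]].
have M0 : M * (t k ^+ 0 / t k ^+ d) @[k --> \oo] --> (0 : R).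
  rewrite -[0 : R](mulr0 M); apply: cvgMl_tmp.
  by have := cvg_expr_ratio _ toy (leq0n d); rewrite (ltn_eqF d0); exact.
apply: ler_cvg_to (recession_cvg pd toy xv) M0 _.
have := toy; move/cvgryPgt/(_ 0); apply: filterS => k k0.
rewrite expr0 mul1r ler_wpM2r ?pM// invr_ge0 exprn_ge0// ltW//.
Qed.

Lemma recession_eq0 (R : realType) (n d : nat) (p : mpolynomial R n)
    (A : set 'rV[R]_n) (L M : R) (v : 'rV[R]_n) :
  (deg p <= d)%N -> (0 < d)%N -> (forall x, A x -> L <= peval p x <= M) ->
  asymptotic_cone A v -> recession d p v = 0.
Proof.
move=> pd d0 pLM Cv; apply/eqP; rewrite eq_le; apply/andP; split.
  by apply: recession_le0 pd d0 _ Cv => x /pLM /andP[_]; exact.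
rewrite -oppr_le0; have -> : - recession d p v = recession d (- p) v.
  rewrite !recessionE ?/deg ?mmeasureN//.
  rewrite /leading_form -sumrN (perm_big _ (msuppN p)); apply: eq_bigr => m _.
  by rewrite mcoeffN mulNr mulrN.
apply: (@recession_le0 _ _ _ (- p) A (- L)) d0 _ Cv.
  by rewrite /deg mmeasureN.
by move=> x /pLM /andP[Lp _]; rewrite /peval mevalN lerN2.
Qed.

(** A polynomial of degree 0 is its own recession polynomial, which therefore
    need not vanish; being constant is what matters for minimisation. *)
Lemma recession_deg0 (R : realType) (n : nat) (p : mpolynomial R n)
    (u v : 'rV[R]_n) : deg p = 0%N -> recession 0 p u = recession 0 p v.
Proof.
rewrite /deg => p0; have /msize1_polyC -> : (msize p <= 1)%N.
  by case: (msize p) p0 => //= k ->.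
rewrite /recession (_ : (fun t => _ / _) =
  fun t => peval (mpolyC n (mcoeff mnm0 p)) (t *: v) / t ^+ 0) //.
by apply/funext => t; rewrite /peval !mevalC.
Qed.

(** * Efficient points from bounded sections *)

Section EfficientPoints.
Context (R : realType) (n q : nat) (K : set 'rV[R]_n).
Context (f : 'I_q -> mpolynomial R n) (xb : 'rV[R]_n).

Lemma section_le i x : section_at K f xb x -> peval (f i) x <= peval (f i) xb.
Proof. by case=> _ /(_ i); rewrite !mxE subr_ge0. Qed.

Lemma section_closed : closed K -> closed (section_at K f xb).
Proof.
move=> Kc; have -> : section_at K f xb = K `&`
    \bigcap_i [set x | peval (f i) x <= peval (f i) xb].
  apply/seteqP; split => x [Kx fx]; split=> //.
  - by move=> i _; apply: section_le.
  - by move=> i; rewrite !mxE subr_ge0; exact: fx.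
apply: closedI => //; apply: closed_bigI => i _.
by apply: closed_sublevel; exact: peval_continuous.
Qed.

(** Minimising the sum of the f i works because all weights are positive: a
    point that dominates the minimiser has the same sum, hence the same value
    in every component. *)
Lemma SOLs_neq0_of_bounded_section :
  closed K -> K xb -> bounded_set (section_at K f xb) ->
  SOLs K (veval f) !=set0.
Proof.
move=> Kc Kxb bA.
have [|||x Ax xmin] := @EVT_min_rV R n (peval (\sum_i f i)) (section_at K f xb).
- by exists xb; split=> // i; rewrite subrr mxE.
- by apply: bounded_closed_compact bA _; exact: section_closed.
- by apply: continuous_subspaceT; exact: peval_continuous.
rewrite inE in Ax; have [Kx fx] := Ax.
exists x; split=> // z Kz [[y y0 yE] /= ne].
have fzx i : peval (f i) z <= peval (f i) x.
  have /rowP/(_ i) := yE; rewrite !mxE => E.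
  by rewrite -subr_le0 -E oppr_le0; exact: y0.
have /xmin : z \in section_at K f xb.
  rewrite inE; split=> // i; rewrite !mxE subr_ge0.
  exact: le_trans (fzx i) (section_le i Ax).
have pevalS w : peval (\sum_i f i) w = \sum_i peval (f i) w.
  by rewrite /peval raddf_sum.
rewrite !pevalS => xz; apply: ne; apply/rowP => i; rewrite !mxE.
have /eqP : \sum_i (peval (f i) x - peval (f i) z) = 0.
  apply/eqP; rewrite eq_le sumr_ge0 ?andbT => [|j _]; last by rewrite subr_ge0.
  by rewrite sumrB subr_le0.
rewrite psumr_eq0 => [/allP/(_ i)|j _]; last by rewrite subr_ge0.
by rewrite mem_index_enum => /(_ isT)/eqP/(congr1 -%R); rewrite opprB oppr0.
Qed.

(** B stands for the solution set of the recession problem, which the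
    regularity hypotheses assume bounded. *)
Lemma SOLs_neq0_of_cone_subset (B : set 'rV[R]_n) : closed K -> K xb ->
  bounded_set B -> asymptotic_cone (section_at K f xb) `<=` B ->
  SOLs K (veval f) !=set0.
Proof.
move=> Kc Kxb bB CB; apply: SOLs_neq0_of_bounded_section => //.
by apply: bounded_of_asymptotic_cone; exact: bounded_subset CB bB.
Qed.

Lemma peval_weighted_sum (l : 'rV[R]_q) (x : 'rV[R]_n) :
  peval (weighted_sum l f) x = \sum_i l 0 i * peval (f i) x.
Proof.
rewrite /peval /weighted_sum raddf_sum; apply: eq_bigr => i _.
by rewrite /= mevalZ.
Qed.

(** The weighted sum p is bounded on the section: above by its value at xb as
    the weights are nonnegative, below as only indices in I contribute. Its
    degree may drop below those of the f i by cancellation, even to 0. *)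
Lemma SOLs_neq0_of_I_zero_regular (I : set 'I_q) : closed K -> K xb ->
  rel_I_zero_regular I (section_at K f xb) K f ->
  I_section_bounded_below I K f xb -> SOLs K (veval f) !=set0.
Proof.
move=> Kc Kxb [_ [l [[l0 _] lI]]] /=; set p := weighted_sum l f => bS fI.
apply: (SOLs_neq0_of_cone_subset Kc Kxb bS) => v Cv; split=> // u Cu.
have [p0|p_gt0] := posnP (deg p).
  by rewrite p0 (recession_deg0 u v).
have /choice[c cP] : forall i, exists c : R,
    forall x, section_at K f xb x -> c <= l 0 i * peval (f i) x.
  move=> i; have [->|li] := eqVneq (l 0 i) 0.
    by exists 0 => x _; rewrite mul0r.
  have [c cf] : has_lbound (peval (f i) @` section_at K f xb).
    by apply: fI; rewrite -lI.
  by exists (l 0 i * c) => x Ax; rewrite ler_wpM2l//; apply: cf; exists x.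
have pLM x : section_at K f xb x -> \sum_i c i <= peval p x <= peval p xb.
  move=> Ax; rewrite !peval_weighted_sum; apply/andP; split.
    by apply: ler_sum => i _; exact: cP.
  by apply: ler_sum => i _; rewrite ler_wpM2l ?section_le//; exact: l0.
by rewrite !(recession_eq0 (leqnn _) p_gt0 pLM).
Qed.

Context (d : 'I_q -> nat) (deg_f : forall i, deg (f i) = d i).
Context (d_ge1 : forall i, (1 <= d i)%N).

Lemma section_recession_eq0 i v :
  has_lbound (peval (f i) @` section_at K f xb) ->
  asymptotic_cone (section_at K f xb) v -> recession (d i) (f i) v = 0.
Proof.
move=> [c cf]; apply: (@recession_eq0 _ _ _ _ _ c (peval (f i) xb)).
- by rewrite deg_f.
- exact: d_ge1.
- by move=> x Ax; rewrite section_le// andbT; apply: cf; exists x.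
Qed.

(** A single component that is constant (zero) on the cone already makes every
    point of the cone weakly efficient. *)
Lemma SOLs_neq0_of_strongly_regular (I : set 'I_q) : closed K -> K xb ->
  rel_strongly_regular d (section_at K f xb) K f -> I !=set0 ->
  I_section_bounded_below I K f xb -> SOLs K (veval f) !=set0.
Proof.
move=> Kc Kxb [_ bS] [i Ii] fI.
apply: (SOLs_neq0_of_cone_subset Kc Kxb bS) => v Cv; split=> // u Cu.
have rec0 w := @section_recession_eq0 i w (fI i Ii).
move=> [y yint /rowP/(_ i)]; rewrite !mxE !rec0// subrr.
move/eqP; rewrite oppr_eq0 => /eqP yi0.
(* An interior point y of the orthant cannot have y_i = 0: decreasing all
   coordinates a little would leave the orthant. *)
have [e /= e0 ey] := (nbhs_ballP _ _).1 yint.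
have /ey/(_ i) : ball y e (y - const_mx (e / 2)).
  split=> // j k; rewrite -ball_normE /= !mxE opprB addrC subrK.
  by rewrite gtr0_norm ?divr_gt0// ltr_pdivrMr// ltr_pMr// ltr1n.
by rewrite !mxE yi0 sub0r oppr_ge0 leNgt divr_gt0.
Qed.

Lemma SOLs_neq0_of_weakly_regular : closed K -> K xb ->
  rel_weakly_regular d (section_at K f xb) K f ->
  section_bounded_below K f xb -> SOLs K (veval f) !=set0.
Proof.
move=> Kc Kxb [_ bS] fb.
apply: (SOLs_neq0_of_cone_subset Kc Kxb bS) => v Cv; split=> // u Cu.
move=> [_]; apply; apply/rowP => i.
by rewrite !mxE !section_recession_eq0 ?subrr//; exact: fb.
Qed.

End EfficientPoints.

Theorem corollary14 (R : realType) (n q : nat) (K : set 'rV[R]_n)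
    (f : 'I_q -> mpolynomial R n) (d : 'I_q -> nat)
    (K_neq0 : K !=set0) (K_unbounded : ~ bounded_set K) (K_closed : closed K)
    (deg_f : forall i, deg (f i) = d i) (d_ge1 : forall i, (1 <= d i)%N) :
  [/\ forall (xb : 'rV[R]_n) (I : set 'I_q), K xb -> I !=set0 ->
        rel_I_zero_regular I (section_at K f xb) K f ->
        I_section_bounded_below I K f xb ->
        SOLs K (veval f) !=set0,
      forall xb : 'rV[R]_n, K xb ->
        rel_zero_regular (section_at K f xb) K f ->
        section_bounded_below K f xb ->
        SOLs K (veval f) !=set0,
      forall xb : 'rV[R]_n, K xb ->
        rel_strongly_regular d (section_at K f xb) K f ->
        (exists I : set 'I_q,
          I !=set0 /\ I_section_bounded_below I K f xb) ->
        SOLs K (veval f) !=set0 &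
      forall xb : 'rV[R]_n, K xb ->
        rel_weakly_regular d (section_at K f xb) K f ->
        section_bounded_below K f xb ->
        SOLs K (veval f) !=set0].
Proof.
split=> [xb I Kxb _|xb Kxb|xb Kxb reg [I [I0 fI]]|xb Kxb].
- exact: SOLs_neq0_of_I_zero_regular.
- exact: SOLs_neq0_of_I_zero_regular.
- exact: SOLs_neq0_of_strongly_regular reg I0 fI.
- exact: SOLs_neq0_of_weakly_regular.
Qed.
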